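(* Let $G$ be a graph on $n$ vertices with Laplacian matrix $L$, and let $k\ge 2$ be an integer. Then the semidefinite program $$\max\ \tfrac12\operatorname{tr}(LY)\quad\text{subject to}\quad \operatorname{diag}(Y)=u_n,\quad kY-J_n\succeq 0,\quad Y\ge 0$$ and the semidefinite program $$\max\ \tfrac{k-1}{2k}\operatorname{tr}(LY)\quad\text{subject to}\quad \operatorname{diag}(Y)=u_n,\quad Y\succeq 0,\quad Y\ge -\tfrac{1}{k-1}J_n$$ (in both, $Y$ ranges over real symmetric $n\times n$ matrices) are equivalent.
   Context: Graphs are finite, simple and undirected. The Laplacian matrix of a graph with adjacency matrix $A$ is $L=\operatorname{Diag}(Au_n)-A$, where $u_n$ is the all-ones vector of length $n$ and $\operatorname{Diag}(v)$ is the diagonal matrix with diagonal $v$; $\operatorname{diag}(Y)$ is the vector of diagonal entries of $Y$. $J_n$ is the $n\times n$ all-ones matrix, $M\succeq 0$ means $M$ is positive semidefinite, and $\ge$ between matrices is entrywise. Two optimization problems are called equivalent if there is a one-to-one correspondence between their feasible solutions under which the objective values coincide (in particular their optimal values are equal). *)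

(* Defs.v *)
From HB Require Import structures.
From mathcomp Require Import all_boot all_order all_algebra.
From mathcomp Require Import boolp classical_sets functions reals ereal.

Set Implicit Arguments.
Unset Strict Implicit.
Unset Printing Implicit Defensive.

Import Order.TTheory GRing.Theory Num.Theory.

Local Open Scope classical_set_scope.
Local Open Scope ring_scope.

Record maximization (R : realType) (T : Type) := Maximization {
  feasible : set T;
  objective : T -> R
}.

Definition opt_value (R : realType) (T : Type) (P : maximization R T) : \bar R :=
  ereal_sup [set (objective P x)%:E | x in feasible P].

(* [f] is total on [T], but only its restriction to the feasible solutions of
   [P] is constrained. *)
Definition equivalent (R : realType) (T U : Type)
    (P : maximization R T) (Q : maximization R U) : Prop :=
  exists f : T -> U,
    set_bij (feasible P) (feasible Q) f /\
    (forall x, feasible P x -> objective Q (f x) = objective P x).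

Record graph (n : nat) := Graph {
  adjacent :> rel 'I_n;
  adjacent_sym : symmetric adjacent;
  adjacent_irr : irreflexive adjacent
}.

Definition ones (R : realType) (n : nat) : 'cV[R]_n := const_mx 1.

Definition all_ones (R : realType) (n : nat) : 'M[R]_n := const_mx 1.

Definition diag_vec (R : realType) (n : nat) (Y : 'M[R]_n) : 'cV[R]_n :=
  \col_i Y i i.

Definition adjacency (R : realType) (n : nat) (G : graph n) : 'M[R]_n :=
  \matrix_(i, j) (G i j)%:R.

(* The transpose is there because [diag_mx] takes a row vector. *)
Definition laplacian (R : realType) (n : nat) (G : graph n) : 'M[R]_n :=
  diag_mx (adjacency R G *m ones R n)^T - adjacency R G.

Definition psd (R : realType) (n : nat) (M : 'M[R]_n) : Prop :=
  M \is symmetricmx /\ forall x : 'cV[R]_n, 0 <= (x^T *m M *m x) 0 0.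

Definition entrywise_ge (R : realType) (m n : nat) (A B : 'M[R]_(m, n)) : Prop :=
  forall i j, B i j <= A i j.

Definition sdp_nonneg (R : realType) (n : nat) (G : graph n) (k : nat) :
    maximization R 'M[R]_n := {|
  feasible := [set Y | [/\ Y \is symmetricmx,
                           diag_vec Y = ones R n,
                           psd (k%:R *: Y - all_ones R n) &
                           entrywise_ge Y 0]];
  objective := fun Y => 1 / 2 * \tr (laplacian R G *m Y)
|}.

Definition sdp_shifted (R : realType) (n : nat) (G : graph n) (k : nat) :
    maximization R 'M[R]_n := {|
  feasible := [set Y | [/\ Y \is symmetricmx,
                           diag_vec Y = ones R n,
                           psd Y &
                           entrywise_ge Y (- (1 / (k%:R - 1)) *: all_ones R n)]];
  objective := fun Y => (k%:R - 1) / (2 * k%:R) * \tr (laplacian R G *m Y)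
|}.

(* Main.v *)
Require Import Defs.
From mathcomp Require Import all_boot all_order all_algebra.
From mathcomp Require Import reals ereal.
From mathcomp Require Import boolp classical_sets functions ring.

(** The affine map [Y |-> (kY - J) / (k - 1)] has an affine inverse and turns
    each constraint of the first program into the corresponding constraint of
    the second.  Since [L J = 0], it multiplies [tr (L Y)] by [k / (k - 1)],
    which is exactly the ratio of the two objective coefficients. *)

Set Implicit Arguments.
Unset Strict Implicit.
Unset Printing Implicit Defensive.

Import Order.TTheory GRing.Theory Num.Theory.

Local Open Scope ring_scope.

(** The bijection preserves values, so both programs attain the same set of objective values, and
    the suprema are taken over equal sets. *)
Lemma equivalent_opt_value (R : realType) (T U : Type)
    (P : maximization R T) (Q : maximization R U) :
  equivalent P Q -> opt_value P = opt_value Q.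
Proof.
move=> [f [[fPQ _ fsurj] fobj]]; congr ereal_sup; apply/seteqP; split => z /=.
- by move=> [x Px <-]; exists (f x); [exact: fPQ | rewrite fobj].
- by move=> [_ /fsurj[x Px <-] <-]; exists x => //; rewrite fobj.
Qed.

(** Inverse laws and equality of objectives are asked on the whole types: the affine maps below
    satisfy them for all matrices, and only the constraints need feasibility. *)
Lemma equivalent_can (R : realType) (T U : Type)
    (P : maximization R T) (Q : maximization R U) (f : T -> U) (g : U -> T) :
  cancel f g -> cancel g f ->
  (forall x, feasible P x -> feasible Q (f x)) ->
  (forall y, feasible Q y -> feasible P (g y)) ->
  (forall x, objective Q (f x) = objective P x) ->
  equivalent P Q.
Proof.
move=> fK gK fPQ gQP fobj; exists f; split; last by move=> x _; exact: fobj.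
split=> //; first by move=> x y _ _; exact: can_inj fK x y.
by move=> y Qy; exists (g y); [exact: gQP | exact: gK].
Qed.

Lemma symmetricmxP (R : realType) (n : nat) (M : 'M[R]_n) :
  reflect (M^T = M) (M \is symmetricmx).
Proof.
have -> : (M \is symmetricmx) = (M == M^T).
  (* [symmetricmx] is the hermitian predicate with sign [(-1)^0] and the identity as conjugation;
     both are stripped here. *)
  by rewrite is_hermitianmxE expr0 scale1r map_mx_id.
by apply: (iffP eqP).
Qed.

Lemma all_ones_sym (R : realType) (n : nat) : all_ones R n \is symmetricmx.
Proof. by apply/symmetricmxP; rewrite trmx_const. Qed.

Lemma symmetricmx_lin (R : realType) (n : nat) (a b : R) (A B : 'M[R]_n) :
  A \is symmetricmx -> B \is symmetricmx -> a *: A + b *: B \is symmetricmx.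
Proof.
move=> /symmetricmxP sA /symmetricmxP sB; apply/symmetricmxP.
by rewrite linearD !linearZ /= sA sB.
Qed.

Lemma psdZ (R : realType) (n : nat) (c : R) (M : 'M[R]_n) :
  0 <= c -> psd M -> psd (c *: M).
Proof.
move=> c0 [sM pM]; split.
  by have := symmetricmx_lin c 0 sM sM; rewrite scale0r addr0.
by move=> x; rewrite -scalemxAr -scalemxAl mxE mulr_ge0.
Qed.

(** Both [Diag(A u) u] and [A u] are the vector of vertex degrees, so they cancel. *)
Lemma laplacian_ones (R : realType) (n : nat) (G : graph n) :
  laplacian R G *m ones R n = 0.
Proof.
rewrite mulmxBl; apply/eqP; rewrite subr_eq0; apply/eqP/matrixP => i j.
by rewrite mul_diag_mx !mxE mulr1; apply: eq_bigr => l _; rewrite !mxE.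
Qed.

Lemma laplacian_all_ones (R : realType) (n : nat) (G : graph n) :
  laplacian R G *m all_ones R n = 0.
Proof.
(* Factoring [J = u u^T] reduces the claim to [L u = 0]. *)
have -> : all_ones R n = ones R n *m (ones R n)^T.
  by apply/matrixP => i j; rewrite !mxE big_ord1 !mxE mulr1.
by rewrite mulmxA laplacian_ones mul0mx.
Qed.

Definition to_shifted (R : realType) (n k : nat) (Y : 'M[R]_n) : 'M[R]_n :=
  (k%:R - 1)^-1 *: (k%:R *: Y - all_ones R n).

Definition of_shifted (R : realType) (n k : nat) (Z : 'M[R]_n) : 'M[R]_n :=
  k%:R^-1 *: ((k%:R - 1) *: Z + all_ones R n).

Section Shift.
Variables (R : realType) (n : nat) (G : graph n) (k : nat).
Hypothesis hk : (2 <= k)%N.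

Let k_gt0 : 0 < k%:R :> R.
Proof. by rewrite ltr0n; apply: leq_trans hk. Qed.

Let k1_gt0 : 0 < k%:R - 1 :> R.
Proof. by rewrite subr_gt0 ltr1n. Qed.

Let k_neq0 : k%:R != 0 :> R.
Proof. exact: lt0r_neq0. Qed.

Let k1_neq0 : k%:R - 1 != 0 :> R.
Proof. exact: lt0r_neq0. Qed.

Lemma to_shiftedK : cancel (@to_shifted R n k) (@of_shifted R n k).
Proof.
by move=> Y; rewrite /of_shifted scalerA divff // scale1r subrK scalerK.
Qed.

Lemma of_shiftedK : cancel (@of_shifted R n k) (@to_shifted R n k).
Proof.
by move=> Z; rewrite /to_shifted scalerA divff // scale1r addrK scalerK.
Qed.

Lemma to_shifted_feasible (Y : 'M[R]_n) :
  feasible (sdp_nonneg R G k) Y -> feasible (sdp_shifted R G k) (to_shifted k Y).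
Proof.
move=> /= [sY /colP dY pY nY].
have pZ : psd (to_shifted k Y) by apply: psdZ => //; rewrite invr_ge0 ltW.
split=> //; first by case: pZ.
- by apply/colP => i; have := dY i; rewrite !mxE => ->; field.
- move=> i j; have := nY i j; rewrite !mxE => Yij.
  (* The [J] term contributes exactly the bound [-1/(k-1)], which leaves [k Y_ij / (k-1) >= 0]. *)
  rewrite mulr1 mul1r mulrBr mulr1 lerDr.
  by rewrite !mulr_ge0 // ?invr_ge0 ltW.
Qed.

Lemma of_shifted_feasible (Z : 'M[R]_n) :
  feasible (sdp_shifted R G k) Z -> feasible (sdp_nonneg R G k) (of_shifted k Z).
Proof.
move=> /= [sZ /colP dZ pZ nZ]; split.
- have := symmetricmx_lin (k%:R^-1 * (k%:R - 1)) k%:R^-1 sZ (all_ones_sym R n).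
  by rewrite -scalerA -scalerDr.
- by apply/colP => i; have := dZ i; rewrite !mxE => ->; field.
(* With [Y] the image of [Z], [kY - J] is just [(k-1) Z]. *)
- by rewrite scalerA divff // scale1r addrK; apply: psdZ => //; exact: ltW.
- move=> i j; have := nZ i j; rewrite !mxE mulr1 mul1r => Zij.
  (* It remains to see that [(k-1) Z_ij >= -1], which is the entrywise bound on [Z] multiplied by
     [k-1 > 0]. *)
  rewrite mulr_ge0 ?invr_ge0 ?(ltW k_gt0) // -lerBlDr sub0r.
  by rewrite -ler_pdivrMl // mulrN1.
Qed.

Lemma to_shifted_objective (Y : 'M[R]_n) :
  objective (sdp_shifted R G k) (to_shifted k Y) =
  objective (sdp_nonneg R G k) Y.
Proof.
rewrite /= -scalemxAr mulmxBr laplacian_all_ones subr0 -scalemxAr !mxtraceZ.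
by field; rewrite k_neq0 k1_neq0.
Qed.

End Shift.

Theorem proposition2 (R : realType) (n : nat) (G : graph n) (k : nat)
    (hk : (2 <= k)%N) :
  equivalent (sdp_nonneg R G k) (sdp_shifted R G k) /\
  opt_value (sdp_nonneg R G k) = opt_value (sdp_shifted R G k).
Proof.
suff E : equivalent (sdp_nonneg R G k) (sdp_shifted R G k).
  by split=> //; exact: equivalent_opt_value.
apply: (equivalent_can (to_shiftedK hk) (of_shiftedK hk)).
- exact: to_shifted_feasible.
- exact: of_shifted_feasible.
- exact: to_shifted_objective.
Qed.
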